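(* Consider the two-user, two-file broadcast caching network with correlated sources described in the context, with library generated by a 2-component discrete memoryless source $(\mathsf X_1,\mathsf X_2)\sim p(x_1,x_2)$ and (normalized) cache capacity $M\ge 0$ per receiver. Then the optimal peak rate-memory function satisfies $R^*(M)\ge R^{LB}(M)$, where \[ R^{LB}(M)=\inf\Big\{R:\; R\ge H(\mathsf X_1,\mathsf X_2)-2M,\;\; R\ge \tfrac12\big(H(\mathsf X_1,\mathsf X_2)-M\big),\;\; R\ge \tfrac12\Big(H(\mathsf X_1,\mathsf X_2)+\max\{H(\mathsf X_1),H(\mathsf X_2)\}\Big)-M\Big\}. \]
   Context: A 2-component discrete memoryless source (2-DMS) consists of finite alphabets $\mathcal X_1,\mathcal X_2$ and a joint pmf $p(x_1,x_2)$; it generates an i.i.d. process $\{(\mathsf X_{1i},\mathsf X_{2i})\}$ with $(\mathsf X_1,\mathsf X_2)\sim p$. For block length $n$ the library consists of the two files $X_1^n\in\mathcal X_1^n$ and $X_2^n\in\mathcal X_2^n$. One sender is connected to two receivers $r_1,r_2$ through a shared error-free broadcast link; each receiver has a cache of $nM$ bits. A cache-aided coded multicast (CACM) scheme of block length $n$ consists of: cache encoders $f^{\mathfrak C}_{r_i}:\mathcal X_1^n\times\mathcal X_2^n\to[1:2^{nM})$, giving cache contents $Z_{r_i}=f^{\mathfrak C}_{r_i}(X_1^n,X_2^n)$, $i=1,2$ (chosen before demands are known); for each demand vector $\mathbf d=(d_{r_1},d_{r_2})\in\{1,2\}^2$ (receiver $r_i$ requests file $X^n_{d_{r_i}}$),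 a multicast encoder producing a variable-length binary codeword $Y_{\mathbf d}=f^{\mathfrak M}(\mathbf d,Z_{r_1},Z_{r_2},X_1^n,X_2^n)$; and decoders $\widehat X^n_{d_{r_i}}=g^{\mathfrak M}_{r_i}(\mathbf d,Y_{\mathbf d},Z_{r_i})$. The worst-case error probability is $P_e^{(n)}=\max_{\mathbf d}\max_{i}\mathbb P(\widehat X^n_{d_{r_i}}\ne X^n_{d_{r_i}})$ and the peak rate is $R^{(n)}=\max_{\mathbf d}\mathbb E[L(Y_{\mathbf d})]/n$, where $L(\cdot)$ is codeword length in bits and the expectation is over the library. A pair $(R,M)$ is achievable if there is a sequence of CACM schemes with cache capacity $M$ and increasing $n$ such that $P_e^{(n)}\to0$ and $\limsup_n R^{(n)}\le R$. The peak rate-memory region is the closure of the set of achievable pairs, and $R^*(M)=\inf\{R:(R,M)\text{ in this region}\}$. *)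

(* Defs.v *)
From HB Require Import structures.
From mathcomp Require Import all_boot all_order all_algebra.
From mathcomp Require Import all_classical all_reals all_analysis.
Set Implicit Arguments. Unset Strict Implicit. Unset Printing Implicit Defensive.
Import Order.TTheory GRing.Theory Num.Theory.
Import numFieldNormedType.Exports.
Local Open Scope classical_set_scope.
Local Open Scope ring_scope.

Section CACM.
Variables (R : realType) (X1 X2 : finType) (p : X1 -> X2 -> R).

(* binary logarithm; entropies are in bits (ln 0 = 0, so 0 log 0 = 0) *)
Definition log2 (x : R) : R := ln x / ln 2.

Definition H12 : R := - \sum_(a : X1) \sum_(b : X2) p a b * log2 (p a b).
Definition p1 (a : X1) : R := \sum_(b : X2) p a b.
Definition p2 (b : X2) : R := \sum_(a : X1) p a b.
Definition H1 : R := - \sum_(a : X1) p1 a * log2 (p1 a).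
Definition H2 : R := - \sum_(b : X2) p2 b * log2 (p2 b).

Definition lib (n : nat) := ({ffun 'I_n -> X1} * {ffun 'I_n -> X2})%type.

Definition plib (n : nat) (x : lib n) : R := \prod_(i < n) p (x.1 i) (x.2 i).

(* demand vector (d_{r1}, d_{r2}); file index 0 stands for X1, 1 for X2 *)
Definition demand := ('I_2 * 'I_2)%type.

Definition file_eq (n : nat) (j : 'I_2) (x y : lib n) : bool :=
  if val j == 0%N then x.1 == y.1 else x.2 == y.2.

(* A CACM scheme of block length n and cache capacity M.  Cache contents are
   integers in [1 : 2^{nM}] ; the multicast codeword is a variable-length
   binary string; each decoder outputs an estimate of the library, of which
   only the requested file is used. *)
Record cacm (n : nat) (M : R) := CACM {
  cache1 : lib n -> nat ;
  cache2 : lib n -> nat ;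
  cache1_range : forall x, (1 <= cache1 x)%N /\ (cache1 x)%:R <= 2 `^ (n%:R * M) ;
  cache2_range : forall x, (1 <= cache2 x)%N /\ (cache2 x)%:R <= 2 `^ (n%:R * M) ;
  menc : demand -> nat -> nat -> lib n -> seq bool ;
  dec1 : demand -> seq bool -> nat -> lib n ;
  dec2 : demand -> seq bool -> nat -> lib n }.

Definition codeword n M (S : cacm n M) (d : demand) (x : lib n) : seq bool :=
  menc S d (cache1 S x) (cache2 S x) x.

Definition perr n M (S : cacm n M) (d : demand) (i : 'I_2) : R :=
  \sum_(x : lib n)
     plib x * (if val i == 0%N then
                 (~~ file_eq d.1 (dec1 S d (codeword S d x) (cache1 S x)) x)%:R
               else
                 (~~ file_eq d.2 (dec2 S d (codeword S d x) (cache2 S x)) x)%:R).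

Definition Pe n M (S : cacm n M) : R :=
  \big[Num.max/0]_(d : demand) \big[Num.max/0]_(i < 2) perr S d i.

Definition elen n M (S : cacm n M) (d : demand) : R :=
  \sum_(x : lib n) plib x * (size (codeword S d x))%:R.

Definition rate n M (S : cacm n M) : R :=
  (\big[Num.max/0]_(d : demand) elen S d) / n%:R.

Definition achievable (Rt M : R) : Prop :=
  exists (ns : nat -> nat) (S : forall k, cacm (ns k) M),
    (forall k, (ns k < ns k.+1)%N) /\
    (Pe (S k) @[k --> \oo] --> (0 : R)) /\
    (limn_esup (fun k => ((rate (S k))%:E)) <= Rt%:E)%E.

Definition region : set (R * R) :=
  closure [set RM : R * R | achievable RM.1 RM.2].

Definition Rstar (M : R) : \bar R :=
  ereal_inf [set Rt%:E | Rt in [set Rt : R | region (Rt, M)]].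

Definition RLB (M : R) : \bar R :=
  ereal_inf [set Rt%:E | Rt in [set Rt : R |
     [/\ Rt >= H12 - 2 * M,
         Rt >= (H12 - M) / 2 &
         Rt >= (H12 + Num.max H1 H2) / 2 - M]]].

End CACM.

(* Main.v *)
Require Import Defs.
From HB Require Import structures.
From mathcomp Require Import all_boot all_order all_algebra.
From mathcomp Require Import all_classical all_reals all_analysis.
From mathcomp Require Import ring lra zify.
Import Order.TTheory GRing.Theory Num.Theory.
Import numFieldNormedType.Exports.
Local Open Scope ring_scope.

(** A cut-set argument. The cache contents and codewords of suitable demands,
    together with a genie variable that reveals the library when some decoder
    fails, determine the library. Demand [(1,2)] with both caches gives
    [H(X1,X2) <= 2M + R]; demands [(1,1)] and [(2,1)] with the first cache give
    [H(X1,X2) <= M + 2R]; and submodularity of the entropy applied to the pairs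
    (first cache, codeword for [(j,j')]) and (second cache, codeword for
    [(j',j)]), which both determine file [j], gives
    [H(X1,X2) + H(Xj) <= 2M + 2R]. All entropies are bounded above by Gibbs'
    inequality against an explicit subprobability, and the bounds, being closed
    conditions, pass from achievable pairs to the closure. *)

(** * Subprobabilities on possibly infinite types *)

Section Subprobability.
Context {R : realType}.

(* Quantifying over duplicate-free lists avoids infinite sums on codewords. *)
Definition subprob {T : eqType} (q : T -> R) : Prop :=
  (forall v, 0 <= q v) /\ forall s : seq T, uniq s -> \sum_(v <- s) q v <= 1.

Lemma sum_fiber {I T : eqType} (r : seq I) (f : I -> T) (G : I -> R) :
  \sum_(i <- r) G i =
  \sum_(v <- undup (map f r)) \sum_(i <- r | f i == v) G i.
Proof.
rewrite (exchange_big_dep xpredT) //=.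
rewrite big_seq [RHS]big_seq; apply: eq_bigr => i ir.
rewrite -big_filter (perm_big [:: f i]); first by rewrite big_seq1.
apply: uniq_perm => //; first by rewrite filter_uniq ?undup_uniq.
move=> v; rewrite mem_filter inE mem_undup eq_sym.
by case: eqP => // ->; rewrite map_f.
Qed.

Lemma sum_uniq_le {T : eqType} (s t : seq T) (F : T -> R) :
  (forall v, 0 <= F v) -> uniq s -> uniq t -> {subset s <= t} ->
  \sum_(v <- s) F v <= \sum_(v <- t) F v.
Proof.
move=> F0 us ut st.
rewrite [leRHS](bigID (mem s)) /=.
suff -> : \sum_(v <- s) F v = \sum_(v <- t | v \in s) F v.
  by rewrite lerDl; apply: sumr_ge0.
rewrite -[RHS]big_filter; apply: perm_big; rewrite perm_sym.
apply: uniq_perm => //; first by rewrite filter_uniq.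
by move=> v; rewrite mem_filter /=; case vs: (v \in s) => //=; apply: st.
Qed.

(** Entries of [s] sharing a first component [a] have distinct second components, so their total is
    at most [q a]; the distinct [a] then total at most 1. This builds the reference laws for
    [ent_submod] and [ent_pair]. *)
Lemma subprob_kernel {T U : eqType} (q : T -> R) (k : T -> U -> R) :
  subprob q -> (forall a, subprob (k a)) ->
  subprob (fun v => q v.1 * k v.1 v.2).
Proof.
move=> [q0 q1] ks; split=> [v|s us].
  by rewrite mulr_ge0 //; case: (ks v.1).
rewrite (sum_fiber s fst).
apply: (@le_trans _ _ (\sum_(a <- undup (map fst s)) q a)); last first.
  by apply: q1; rewrite undup_uniq.
apply: ler_sum => a _.
rewrite (eq_bigr (fun v => q a * k a v.2)); last by move=> v /eqP ->.
rewrite -mulr_sumr ler_piMr //.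
rewrite -big_filter -(big_map snd xpredT (k a)).
apply: (proj2 (ks a)).
rewrite map_inj_in_uniq ?filter_uniq // => -[a1 b1] [a2 b2].
by rewrite !mem_filter /= => /andP[/eqP -> _] /andP[/eqP -> _] ->.
Qed.

End Subprobability.

(** * Entropy of functions on a finite probability space *)

Section Entropy.
Context {R : realType} {Om : finType} (w : Om -> R).
Hypotheses (w0 : forall x, 0 <= w x) (w1 : \sum_x w x = 1).

Definition law {T : eqType} (f : Om -> T) (v : T) : R := \sum_(x | f x == v) w x.

(** Entropy in nats, as an expectation over outcomes. Summing over outcomes instead of values allows
    infinite codomains such as [seq bool]. *)
Definition ent {T : eqType} (f : Om -> T) : R := - \sum_x w x * ln (law f (f x)).

Lemma law_ge0 {T : eqType} (f : Om -> T) v : 0 <= law f v.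
Proof. exact: sumr_ge0. Qed.

Lemma le_law {T : eqType} (f : Om -> T) x : w x <= law f (f x).
Proof. by rewrite /law (bigD1 x) //= lerDl; apply: sumr_ge0. Qed.

Lemma law_gt0 {T : eqType} (f : Om -> T) x : 0 < w x -> 0 < law f (f x).
Proof. by move=> wx; apply: lt_le_trans (le_law f x). Qed.

Lemma subprob_law {T : eqType} (f : Om -> T) : subprob (law f).
Proof.
split=> [|s us]; first exact: law_ge0.
rewrite /law (exchange_big_dep xpredT) //= -[leRHS]w1.
apply: ler_sum => x _.
rewrite -big_filter.
apply: le_trans (_ : \sum_(v <- [:: f x]) w x <= _).
  apply: sum_uniq_le => //; first by rewrite filter_uniq.
  by move=> v; rewrite mem_filter inE eq_sym => /andP[].
by rewrite big_seq1.
Qed.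

(* Conditioning on a null event gives the zero function, as [x / 0 = 0]. *)
Lemma subprob_cond {T U : eqType} (f : Om -> T) (g : Om -> U) (a : T) :
  subprob (fun b => law (fun x => (f x, g x)) (a, b) / law f a).
Proof.
split=> [v|s us]; first by rewrite divr_ge0 // law_ge0.
rewrite -mulr_suml.
have [->|fa] := eqVneq (law f a) 0; first by rewrite invr0 mulr0.
rewrite ler_pdivrMr ?mul1r ?lt0r ?fa ?law_ge0 //.
rewrite /law (exchange_big_dep (fun x => f x == a)) /=; last first.
  by move=> b x _ /eqP[-> _].
apply: ler_sum => x fx.
rewrite -big_filter.
apply: le_trans (_ : \sum_(v <- [:: g x]) w x <= _).
  apply: sum_uniq_le => //; first by rewrite filter_uniq.
  by move=> v; rewrite mem_filter inE => /andP[/eqP[_ ->]].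
by rewrite big_seq1.
Qed.

(** Apply [ln t <= t - 1] to [t = q / law f] and average: grouping outcomes by the value [v] of [f]
    shows that the mean of [t] is at most the sum of [q v], hence at most 1. *)
Lemma gibbs {T : eqType} (f : Om -> T) (q : T -> R) : subprob q ->
  (forall x, 0 < w x -> 0 < q (f x)) ->
  ent f <= - \sum_x w x * ln (q (f x)).
Proof.
move=> [q0 q1] qpos.
rewrite /ent lerN2 -subr_ge0 -sumrB.
have: \sum_x w x * (q (f x) / law f (f x)) <= 1.
  rewrite (sum_fiber _ f).
  apply: le_trans (q1 _ (undup_uniq _)).
  apply: ler_sum => v _.
  rewrite (eq_bigr (fun x => w x * (q v / law f v))); last by move=> x /eqP->.
  rewrite -mulr_suml -/(law f v).
  have [->|fv] := eqVneq (law f v) 0; first by rewrite mul0r.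
  by rewrite mulrC divfK.
rewrite -subr_ge0 -{1}w1 -sumrB => /le_trans; apply.
apply: ler_sum => x _.
have [->|wx] := eqVneq (w x) 0; first by rewrite !mul0r !subr0.
have {wx}wx : 0 < w x by rewrite lt0r wx w0.
have P := law_gt0 f x wx; have Q := qpos _ wx.
rewrite -mulrBr -{1}(mulr1 (w x)) -mulrBr ler_wpM2l //.
have D : 0 < q (f x) / law f (f x) by rewrite divr_gt0.
have := @le_ln1Dx R (q (f x) / law f (f x) - 1) ltac:(lra).
rewrite [1 + _]addrC subrK lnM ?lnV ?posrE ?invr_gt0 //; lra.
Qed.

(** Each fibre of [g] lies inside a fibre of [f], so the law of [g] is pointwise the smaller one. *)
Lemma ent_le {T U : eqType} (f : Om -> T) (g : Om -> U) :
  (forall x y, g x = g y -> f x = f y) -> ent f <= ent g.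
Proof.
move=> gf; rewrite /ent lerN2; apply: ler_sum => x _.
have [->|wx] := eqVneq (w x) 0; first by rewrite !mul0r.
have {wx}wx : 0 < w x by rewrite lt0r wx w0.
rewrite ler_wpM2l //.
have Pg := law_gt0 g x wx; have Pf := law_gt0 f x wx.
rewrite ler_ln ?posrE // /law [leRHS](bigID (fun y => g y == g x)) /=.
rewrite [X in _ <= X + _](eq_bigl (fun y => g y == g x)).
  by rewrite lerDl sumr_ge0.
move=> y; have [E|] := eqVneq (g y) (g x); last by rewrite andbF.
by rewrite (gf _ _ E) eqxx.
Qed.

(* Gibbs' inequality against the law [P(a,b) P(a,c) / P(a)], under which [g]
   and [h] are conditionally independent given [f]. *)
Lemma ent_submod {T U V : eqType} (f : Om -> T) (g : Om -> U) (h : Om -> V) :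
  ent (fun x => ((f x, g x), h x)) + ent f <=
  ent (fun x => (f x, g x)) + ent (fun x => (f x, h x)).
Proof.
pose fg x := (f x, g x); pose fh x := (f x, h x).
pose q (v : (T * U) * V) := law fg v.1 * (law fh (v.1.1, v.2) / law f v.1.1).
have sq : subprob q.
  by exact: (subprob_kernel _ (fun v c => law fh (v.1, c) / law f v.1)
    (subprob_law fg) (fun v => subprob_cond f h v.1)).
have pos x : 0 < w x ->
    [/\ 0 < law fg (fg x), 0 < law fh (fh x) & 0 < law f (f x)].
  by move=> wx; split; apply: law_gt0.
have qpos x : 0 < w x -> 0 < q (fg x, h x).
  by move=> /pos[? ? ?]; rewrite mulr_gt0 ?divr_gt0.
rewrite -lerBrDr; apply: (le_trans (gibbs _ _ sq qpos)); rewrite /q /=.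
rewrite /ent.
suff: \sum_x (w x * ln (law fg (fg x)) + w x * ln (law fh (fh x)) -
               w x * ln (law f (f x))) <=
      \sum_x w x * ln (law fg (fg x) * (law fh (fh x) / law f (f x))).
  rewrite sumrB big_split /=; lra.
apply: ler_sum => x _.
have [->|wx] := eqVneq (w x) 0; first by rewrite !mul0r; lra.
have {wx}wx : 0 < w x by rewrite lt0r wx w0.
have [A B C] := pos x wx.
rewrite !lnM ?lnV ?posrE ?divr_gt0 ?invr_gt0 //.
lra.
Qed.

(** Gibbs' inequality against the product of the two marginal laws. *)
Lemma ent_pair {T U : eqType} (f : Om -> T) (g : Om -> U) :
  ent (fun x => (f x, g x)) <= ent f + ent g.
Proof.
pose q (v : T * U) := law f v.1 * law g v.2.
have sq : subprob q.
  exact: (subprob_kernel _ (fun=> law g) (subprob_law f) (fun=> subprob_law g)).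
have qpos x : 0 < w x -> 0 < q (f x, g x).
  by move=> wx; rewrite mulr_gt0 ?law_gt0.
apply: (le_trans (gibbs _ _ sq qpos)); rewrite /q /=.
rewrite /ent -opprD lerN2 -big_split /=; apply: ler_sum => x _.
have [->|wx] := eqVneq (w x) 0; first by rewrite !mul0r; lra.
have {wx}wx : 0 < w x by rewrite lt0r wx w0.
by rewrite lnM ?posrE ?law_gt0 // mulrDr.
Qed.

End Entropy.

(** * Upper bounds for the entropies of caches, codewords and the genie *)

Section EntropyBounds.
Context {R : realType} {Om : finType} (w : Om -> R).
Hypotheses (w0 : forall x, 0 <= w x) (w1 : \sum_x w x = 1).

(** The reference puts weight [1 / c] on each integer of [[1, c]]; there are at most [c] of these,
    even when [c] is not an integer. *)
Lemma ent_range (f : Om -> nat) (c : R) : 0 < c ->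
  (forall x, (1 <= f x)%N /\ (f x)%:R <= c) -> ent w f <= ln c.
Proof.
move=> c0 fc; pose q (v : nat) : R := ((0 < v)%N && (v%:R <= c))%:R / c.
have sq : subprob q.
  split=> [v|s us]; first by rewrite divr_ge0 // ltW.
  rewrite -mulr_suml ler_pdivrMr // mul1r -natr_sum.
  set r := [seq v <- s | (0 < v)%N && (v%:R <= c)].
  have: (size r <= size (iota 1 (Num.truncn c)))%N.
    apply: uniq_leq_size; first by rewrite filter_uniq.
    move=> v; rewrite mem_filter mem_iota => /andP[/andP[-> vc] _] /=.
    by rewrite add1n ltnS truncn_ge_nat // ltW.
  rewrite size_iota truncn_ge_nat; last exact: ltW.
  apply: le_trans; rewrite /r size_filter -sum1_count ler_nat [leqRHS]big_mkcond.
  by apply: leq_sum => v _; case: (_ && _).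
have qE x : q (f x) = c^-1.
  by rewrite /q; case: (fc x) => -> ->; rewrite mul1r.
apply: le_trans (gibbs w w0 w1 f q sq _) _ => [x _|].
  by rewrite qE invr_gt0.
under eq_bigr do rewrite qE lnV ?posrE // mulrN.
by rewrite sumrN opprK -mulr_suml w1 mul1r.
Qed.

(** A finite set of words, closed under taking shorter words, on which the geometric sum can be
    bounded by induction on the length. *)
Fixpoint words_upto (N : nat) : seq (seq bool) :=
  if N is N'.+1 then
    [::] :: (map (cons true) (words_upto N') ++ map (cons false) (words_upto N'))
  else [:: [::]].

Lemma words_uptoP N y : (size y <= N)%N -> y \in words_upto N.
Proof.
elim: N y => [|N IH] [|b y] //= yN; rewrite inE /= mem_cat.
by apply/orP; case: b; [left|right]; rewrite map_f // IH.
Qed.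

Lemma words_upto_uniq N : uniq (words_upto N).
Proof.
have consI b : injective (cons b : seq bool -> seq bool) by move=> ? ? [].
elim: N => //= N IH; rewrite mem_cat cat_uniq !map_inj_uniq ?IH // andbT.
apply/andP; split; first by apply/norP; split; apply/mapP => -[].
by rewrite andTb; apply/hasPn => _ /mapP[y _ ->]; apply/mapP => -[].
Qed.

(** There are [2 ^ k] words of length [k], so the full sum is geometric with ratio [2 * l]. The
    bound [B] solves [B = 1 + 2 * l * B], which is the recursion given by splitting on the first
    bit. *)
Lemma sum_words_le (l : R) (s : seq (seq bool)) :
  0 <= l -> l < 2^-1 -> uniq s -> \sum_(y <- s) l ^+ size y <= (1 - 2 * l)^-1.
Proof.
move=> l0 l2 us.
have l3 : 0 < 1 - 2 * l by lra.
pose N := \max_(y <- s) size y.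
apply: (@le_trans _ _ (\sum_(y <- words_upto N) l ^+ size y)).
  apply: sum_uniq_le => [y||| y ys] //.
  - by rewrite exprn_ge0.
  - exact: words_upto_uniq.
  - by apply/words_uptoP; exact: leq_bigmax_seq.
elim: N => [|N IH] /=.
  rewrite big_seq1 expr0 -[leLHS]invr1 lef_pV2 ?posrE //; lra.
have E (b : bool) : \sum_(y <- words_upto N) l ^+ size (b :: y) =
    l * \sum_(y <- words_upto N) l ^+ size y.
  by rewrite mulr_sumr; apply: eq_bigr => y _; rewrite exprS.
rewrite big_cons big_cat !big_map expr0 /= (E true).
set B := (1 - 2 * l)^-1 in IH *.
have -> : B = 1 + 2 * l * B by rewrite /B; field; lra.
set S := \sum_(j <- _) _ in IH *.
nra.
Qed.

(* Codewords need not be prefix free: the law [(1 - 2l) l ^ |y|] with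
   [l = exp (- dl) / 2] charges [ln 2 + dl] per bit, up to a constant. *)
Lemma ent_word (f : Om -> seq bool) (dl : R) : 0 < dl ->
  ent w f <= (ln 2 + dl) * (\sum_x w x * (size (f x))%:R)
             - ln (1 - expR (- dl)).
Proof.
move=> dl0; pose l : R := expR (- dl) / 2.
have e1 : expR (- dl) < 1 by rewrite -expR0 ltr_expR; lra.
have e0 := expR_gt0 (- dl).
have l0 : 0 < l by rewrite /l; lra.
have l2 : l < 2^-1 by rewrite /l; lra.
have ll : 2 * l = expR (- dl) by rewrite /l; lra.
pose q (y : seq bool) := (1 - expR (- dl)) * l ^+ size y.
have sq : subprob q.
  split=> [y|s us]; first by rewrite mulr_ge0 ?exprn_ge0 ?subr_ge0 // ltW.
  have := sum_words_le l s (ltW l0) l2 us.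
  rewrite ll -mulr_sumr => /(ler_wpM2l (_ : 0 <= 1 - expR (- dl))).
  by rewrite divff ?subr_eq0 ?gt_eqF //; apply; lra.
have qpos y : 0 < q y by rewrite mulr_gt0 ?exprn_gt0 ?subr_gt0.
apply: le_trans (gibbs w w0 w1 f q sq (fun x _ => qpos _)) _.
have qE y : ln (q y) = ln (1 - expR (- dl)) - (ln 2 + dl) * (size y)%:R.
  rewrite lnM ?posrE ?subr_gt0 ?exprn_gt0 // lnXn // -[_ *+ size y]mulr_natr.
  rewrite /l lnM ?posrE ?invr_gt0 // lnV ?posrE // expRK; ring.
under eq_bigr do rewrite qE mulrBr mulrCA.
rewrite sumrB -mulr_suml -mulr_sumr w1; lra.
Qed.

(** The reference gives mass 1/2 to [None] and spreads the other half uniformly over the outcomes,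
    so only outcomes in [e] pay [ln #|Om|]. *)
Lemma ent_partial_id (e : pred Om) :
  ent w (fun x => if e x then Some x else None)
  <= ln 2 + (\sum_(x | e x) w x) * ln #|Om|%:R.
Proof.
have N0 : 0 < #|Om|%:R :> R.
  rewrite ltr0n lt0n; apply/eqP => /card0_eq O.
  suff /eqP: 1 = 0 :> R by rewrite oner_eq0.
  by rewrite -w1 big1 // => x _; have := O x; rewrite inE.
pose q (v : option Om) : R := if v is Some _ then (2 * #|Om|%:R)^-1 else 2^-1.
have q0 v : 0 < q v by case: v => [x|]; rewrite invr_gt0 ?mulr_gt0.
have sq : subprob q.
  split=> [v|s us]; first exact: ltW.
  apply: (@le_trans _ _ (\sum_(v <- None :: map Some (enum Om)) q v)).
    apply: sum_uniq_le => // [v||]; first exact: ltW.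
      have sI : injective (@Some Om) by move=> ? ? [].
      rewrite /= (map_inj_uniq sI) enum_uniq andbT.
      by apply/mapP => -[].
    by move=> [x|] _; rewrite inE //= map_f ?mem_enum.
  rewrite big_cons big_map big_enum /= sumr_const invfM -[X in _ + X]mulr_natr.
  by rewrite -mulrA mulVf ?gt_eqF //; lra.
apply: le_trans (gibbs w w0 w1 _ q sq (fun x _ => q0 _)) _.
have -> : ln 2 = \sum_x w x * ln 2 :> R by rewrite -mulr_suml w1 mul1r.
rewrite -sumrN mulr_suml [X in _ + X]big_mkcond -big_split /=.
apply: ler_sum => x _.
case: (e x); rewrite /q lnV ?posrE ?mulr_gt0 // ?lnM ?posrE //; lra.
Qed.

End EntropyBounds.

(** * The library law and its entropies *)

Section Memoryless.
Context {R : realType} {X1 X2 : finType} (p : X1 -> X2 -> R).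
Hypothesis p_ge0 : forall a b, 0 <= p a b.
Hypothesis p_sum1 : \sum_(a : X1) \sum_(b : X2) p a b = 1.

(** The factor may depend on the coordinate, so that one coordinate can be treated apart in
    [sum_plib_additive]. *)
Lemma sum_lib_prod n (F : 'I_n -> X1 -> X2 -> R) :
  \sum_(x : lib X1 X2 n) \prod_i F i (x.1 i) (x.2 i) =
  \prod_i \sum_a \sum_b F i a b.
Proof.
rewrite -(pair_bigA _ (fun (x1 : {ffun 'I_n -> X1}) (x2 : {ffun 'I_n -> X2}) =>
  \prod_i F i (x1 i) (x2 i))) /=.
under eq_bigr => x1 _ do rewrite -(bigA_distr_bigA (fun i b => F i (x1 i) b)).
by rewrite -(bigA_distr_bigA (fun i a => \sum_b F i a b)).
Qed.

Lemma plib_ge0 n (x : lib X1 X2 n) : 0 <= plib p x.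
Proof. by apply: prodr_ge0. Qed.

Lemma plib_sum1 n : \sum_(x : lib X1 X2 n) plib p x = 1.
Proof. by rewrite (sum_lib_prod n (fun=> p)) big1. Qed.

Lemma sum_plib_additive n (g : X1 -> X2 -> R) :
  \sum_(x : lib X1 X2 n) plib p x * \sum_i g (x.1 i) (x.2 i) =
  n%:R * \sum_a \sum_b p a b * g a b.
Proof.
under eq_bigr do rewrite mulr_sumr.
rewrite exchange_big /=.
rewrite (eq_bigr (fun=> \sum_a \sum_b p a b * g a b)).
  by rewrite sumr_const card_ord mulr_natl.
move=> i _.
(* [F] inserts [g] at coordinate [i] only; every other coordinate sums to 1. *)
pose F (j : 'I_n) a b := if j == i then p a b * g a b else p a b.
transitivity (\sum_(x : lib X1 X2 n) \prod_j F j (x.1 j) (x.2 j)).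
  apply: eq_bigr => x _; rewrite /plib (bigD1 i) //= [RHS](bigD1 i) //=.
  rewrite /F eqxx mulrAC; congr (_ * _).
  by apply: eq_bigr => j /negPf ->.
rewrite (sum_lib_prod n F) (bigD1 i) //= [X in _ * X]big1 => [|j /negPf ji].
  by rewrite mulr1 /F eqxx.
by rewrite /F ji.
Qed.

Lemma ent_iid n (T : eqType) (f : lib X1 X2 n -> T) (u : X1 -> X2 -> R) :
  (forall a b, 0 < p a b -> 0 < u a b) ->
  (forall x, law (plib p (n:=n)) f (f x) = \prod_i u (x.1 i) (x.2 i)) ->
  ent (plib p (n:=n)) f = - (n%:R * \sum_a \sum_b p a b * ln (u a b)).
Proof.
move=> upos fu; rewrite /ent -sum_plib_additive; congr (- _).
apply: eq_bigr => x _; rewrite fu.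
(* A library with a letter pair of probability 0 has weight 0. Otherwise every factor is positive
   and the logarithm of the product splits. *)
have [px|] := boolP [forall i, 0 < p (x.1 i) (x.2 i)]; last first.
  move=> /forallPn[i]; rewrite lt0r p_ge0 andbT negbK => /eqP pi.
  by rewrite /plib (bigD1 i) //= pi !mul0r.
congr (_ * _).
have upx i : 0 < u (x.1 i) (x.2 i) by apply: upos; exact: (forallP px).
suff: 0 < \prod_i u (x.1 i) (x.2 i) /\
  ln (\prod_i u (x.1 i) (x.2 i)) = \sum_i ln (u (x.1 i) (x.2 i)) by case.
elim/big_ind2: _ => [|v s v' s' [v0 <-] [v'0 <-]|i _].
- by rewrite ln1.
- by rewrite mulr_gt0 // lnM.
- by [].
Qed.

(** Converts the bits of [H12], [H1] and [H2] into the nats of [ent]; hence the factors [ln 2] in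
    the later bounds. *)
Lemma log2_ln (x : R) : log2 x * ln 2 = ln x.
Proof. by rewrite /log2 divfK // gt_eqF // ln_gt0 // ltr1n. Qed.

Lemma le_p1 a b : p a b <= p1 p a.
Proof. by rewrite /p1 (bigD1 b) //= lerDl sumr_ge0. Qed.

Lemma le_p2 a b : p a b <= p2 p b.
Proof. by rewrite /p2 (bigD1 a) //= lerDl sumr_ge0. Qed.

Lemma ent_lib n : ent (plib p (n:=n)) id = n%:R * (H12 p * ln 2).
Proof.
rewrite (ent_iid n _ id p) // => [|x].
  rewrite -mulrN /H12 mulNr mulr_suml; congr (_ * - _).
  apply: eq_bigr => a _; rewrite mulr_suml; apply: eq_bigr => b _.
  by rewrite -mulrA log2_ln.
by rewrite /law big_pred1_eq.
Qed.

Lemma ent_lib1 n : ent (plib p (n:=n)) fst = n%:R * (H1 p * ln 2).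
Proof.
rewrite (ent_iid n _ fst (fun a _ => p1 p a)).
- rewrite -mulrN /H1 mulNr mulr_suml; congr (_ * - _).
  by apply: eq_bigr => a _; rewrite -mulr_suml -mulrA log2_ln.
- by move=> a b pab; exact: lt_le_trans (le_p1 a b).
- move=> [x1 x2] /=; rewrite /law /plib.
  (* Summing out the second file coordinate by coordinate leaves a product of marginals. *)
  transitivity (\sum_(y : lib X1 X2 n | pred1 x1 y.1 && xpredT y.2)
      \prod_i p (y.1 i) (y.2 i)).
    by apply: eq_bigl => y; rewrite andbT.
  rewrite -(pair_big (pred1 x1) xpredT
    (fun (y1 : {ffun 'I_n -> X1}) (y2 : {ffun 'I_n -> X2}) =>
      \prod_i p (y1 i) (y2 i))) /= big_pred1_eq.
  by rewrite -(bigA_distr_bigA (fun i b => p (x1 i) b)).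
Qed.

Lemma ent_lib2 n : ent (plib p (n:=n)) snd = n%:R * (H2 p * ln 2).
Proof.
rewrite (ent_iid n _ snd (fun _ b => p2 p b)).
- rewrite -mulrN /H2 mulNr mulr_suml exchange_big; congr (_ * - _).
  by apply: eq_bigr => b _; rewrite -mulr_suml -mulrA log2_ln.
- by move=> a b pab; exact: lt_le_trans (le_p2 a b).
- move=> [x1 x2] /=; rewrite /law /plib.
  transitivity (\sum_(y : lib X1 X2 n | xpredT y.1 && pred1 x2 y.2)
      \prod_i p (y.1 i) (y.2 i)); first exact: eq_bigl.
  rewrite -(pair_big xpredT (pred1 x2)
    (fun (y1 : {ffun 'I_n -> X1}) (y2 : {ffun 'I_n -> X2}) =>
      \prod_i p (y1 i) (y2 i))) /= exchange_big big_pred1_eq /=.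
  by rewrite -(bigA_distr_bigA (fun i a => p a (x2 i))).
Qed.

End Memoryless.

(** * Cut-set inequalities for a single scheme *)

Section Converse.
Context {R : realType} {X1 X2 : finType} (p : X1 -> X2 -> R).
Hypothesis p_ge0 : forall a b, 0 <= p a b.
Hypothesis p_sum1 : \sum_(a : X1) \sum_(b : X2) p a b = 1.

Section Scheme.
Context {n : nat} {M : R} (S : cacm X1 X2 n M).
Local Notation w := (plib p (n:=n)).
Local Notation Lib := (lib X1 X2 n).
Let w0 : forall x : Lib, 0 <= w x := plib_ge0 p p_ge0 n.
Let w1 : \sum_(x : Lib) w x = 1 := plib_sum1 p p_sum1 n.

Definition err1 (d : demand) (x : Lib) : bool :=
  ~~ file_eq d.1 (dec1 S d (codeword S d x) (cache1 S x)) x.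
Definition err2 (d : demand) (x : Lib) : bool :=
  ~~ file_eq d.2 (dec2 S d (codeword S d x) (cache2 S x)) x.
Definition err (x : Lib) : bool := [exists d, err1 d x || err2 d x].

(* A genie reveals the whole library whenever some decoder fails; this costs
   little entropy and makes every decoding step exact. *)
Definition genie (x : Lib) : option Lib := if err x then Some x else None.

Lemma perr_le_Pe d i : perr p S d i <= Pe p S.
Proof.
apply: le_trans (le_bigmax _ _ d).
exact: (le_bigmax _ (fun i => perr p S d i) i).
Qed.

(** Union bound over four demands and two receivers, whence the factor 8. *)
Lemma prob_err : \sum_(x | err x) w x <= 8 * Pe p S.
Proof.
apply: (@le_trans _ _ (\sum_d (perr p S d ord0 + perr p S d ord_max))).
  have E d : perr p S d ord0 + perr p S d ord_max =
      \sum_x (w x * (err1 d x)%:R + w x * (err2 d x)%:R) by rewrite big_split.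
  rewrite (eq_bigr _ (fun d _ => E d)).
  rewrite exchange_big big_mkcond /=; apply: ler_sum => x _.
  have nn (d : demand) : 0 <= w x * (err1 d x)%:R + w x * (err2 d x)%:R.
    by rewrite addr_ge0 // mulr_ge0.
  case: ifP => [/existsP[d ed]|_]; last by apply: sumr_ge0 => d _; exact: nn.
  rewrite (bigD1 d) //= -[leLHS]addr0 lerD //; last first.
    by apply: sumr_ge0 => d' _; exact: nn.
  have := w0 x; move: ed; case: (err1 d x); case: (err2 d x) => //= _; lra.
apply: (@le_trans _ _ (\sum_(d : demand) 2 * Pe p S)).
  by apply: ler_sum => d _; rewrite mulr_natl mulr2n lerD // perr_le_Pe.
rewrite sumr_const card_prod !card_ord -mulr_natl; lra.
Qed.

Lemma file_eq_join j (x y z : Lib) :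
  file_eq j z x -> file_eq j z y -> file_eq j x y.
Proof. by rewrite /file_eq; case: ifP => _ /eqP-> /eqP->. Qed.

(** Equal genie values leave two cases. Either both libraries are revealed and so coincide, or no
    decoder fails on either, and the common decoder output agrees with both on the requested
    file. *)
Lemma decode1 d x y : genie x = genie y -> codeword S d x = codeword S d y ->
  cache1 S x = cache1 S y -> file_eq d.1 x y.
Proof.
rewrite /genie; case: ifPn => ex; case: ifPn => ey //.
  by move=> [->] _ _; rewrite /file_eq; case: ifP.
move=> _ cw z; move/existsPn: ex => /(_ d); move/existsPn: ey => /(_ d).
rewrite !negb_or !negbK cw z => /andP[ey _] /andP[ex _].
exact: file_eq_join ex ey.
Qed.

Lemma decode2 d x y : genie x = genie y -> codeword S d x = codeword S d y ->
  cache2 S x = cache2 S y -> file_eq d.2 x y.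
Proof.
rewrite /genie; case: ifPn => ex; case: ifPn => ey //.
  by move=> [->] _ _; rewrite /file_eq; case: ifP.
move=> _ cw z; move/existsPn: ex => /(_ d); move/existsPn: ey => /(_ d).
rewrite !negb_or !negbK cw z => /andP[_ ey] /andP[_ ex].
exact: file_eq_join ex ey.
Qed.

Lemma file_eq_lib (x y : Lib) :
  file_eq ord0 x y -> file_eq ord_max x y -> x = y.
Proof. by case: x y => [? ?] [? ?]; rewrite /file_eq /= => /eqP-> /eqP->. Qed.

(** A bound of Fano type: the logarithm of the number of libraries is linear in [n], so the cost per
    symbol vanishes with [Pe]. *)
Lemma ent_genie :
  ent w genie <= ln 2 + n%:R * (8 * Pe p S * ln #|{: X1 * X2}|%:R).
Proof.
apply: le_trans (ent_partial_id w w0 w1 err) _.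
have c0 : (0 < #|{: X1 * X2}|)%N.
  rewrite lt0n; apply/eqP => O; suff /eqP: 1 = 0 :> R by rewrite oner_eq0.
  by rewrite -p_sum1 pair_big big1 // => x _; have := card0_eq O x; rewrite inE.
have -> : #|{: Lib}| = (#|{: X1 * X2}| ^ n)%N.
  by rewrite !card_prod !card_ffun card_ord expnMn.
rewrite lerD2l natrX lnXn ?ltr0n //.
rewrite -[_ *+ n]mulr_natl mulrCA ler_wpM2l ?ler0n // ler_wpM2r ?ln_ge0 ?ler1n //.
exact: prob_err.
Qed.

Lemma ent_cache1 : ent w (cache1 S) <= n%:R * (M * ln 2).
Proof.
rewrite mulrA -ln_powR; apply: (ent_range w w0 w1 _ _ _ (cache1_range S)).
by rewrite powR_gt0.
Qed.

Lemma ent_cache2 : ent w (cache2 S) <= n%:R * (M * ln 2).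
Proof.
rewrite mulrA -ln_powR; apply: (ent_range w w0 w1 _ _ _ (cache2_range S)).
by rewrite powR_gt0.
Qed.

Lemma ent_codeword dl d : 0 < dl -> (0 < n)%N ->
  ent w (codeword S d) <= n%:R * ((ln 2 + dl) * rate p S) - ln (1 - expR (- dl)).
Proof.
move=> dl0 n0; apply: le_trans (ent_word w w0 w1 _ dl dl0) _.
rewrite lerD2r mulrCA ler_wpM2l //.
  by rewrite addr_ge0 ?ln_ge0 ?ler1n // ltW.
rewrite /rate mulrC divfK ?pnatr_eq0 -?lt0n //.
exact: (le_bigmax _ (elen p S) d).
Qed.

(** Budget in nats for one codeword together with the genie. For fixed [dl], everything but the rate
    term is [o(n)] once [Pe] tends to 0. *)
Definition msg_cost (dl : R) : R :=
  n%:R * ((ln 2 + dl) * rate p S) - ln (1 - expR (- dl)) +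
  (ln 2 + n%:R * (8 * Pe p S * ln #|{: X1 * X2}|%:R)).

Lemma ent_msg dl d : 0 < dl -> (0 < n)%N ->
  ent w (fun x => (codeword S d x, genie x)) <= msg_cost dl.
Proof.
move=> dl0 n0; apply: le_trans (ent_pair w w0 w1 _ _) _.
by rewrite lerD ?ent_codeword ?ent_genie.
Qed.

Lemma cut_two_caches dl : 0 < dl -> (0 < n)%N ->
  n%:R * (H12 p * ln 2) <= n%:R * (2 * M * ln 2) + msg_cost dl.
Proof.
move=> dl0 n0; pose d : demand := (ord0, ord_max).
pose f x := ((codeword S d x, genie x), (cache1 S x, cache2 S x)).
rewrite -ent_lib //; apply: (@le_trans _ _ (ent w f)).
  apply: (ent_le w w0 id f) => x y [cw g z1 z2].
  apply: file_eq_lib.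
  - exact: (decode1 d x y).
  - exact: (decode2 d x y).
have := ent_pair w w0 w1 (fun x => (codeword S d x, genie x))
  (fun x => (cache1 S x, cache2 S x)).
have := ent_pair w w0 w1 (cache1 S) (cache2 S).
have := ent_cache1; have := ent_cache2; have := ent_msg dl d dl0 n0.
rewrite -/f; lra.
Qed.

Lemma cut_two_messages dl : 0 < dl -> (0 < n)%N ->
  n%:R * (H12 p * ln 2) <= n%:R * (1 * M * ln 2) + 2 * msg_cost dl.
Proof.
(* Receiver 1 requests each file in turn, so its cache alone serves both messages. *)
move=> dl0 n0; pose d : demand := (ord0, ord0); pose d' : demand := (ord_max, ord0).
pose m x := (codeword S d x, genie x); pose m' x := (codeword S d' x, genie x).
pose f x := ((m x, m' x), cache1 S x).
rewrite -ent_lib //; apply: (@le_trans _ _ (ent w f)).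
  apply: (ent_le w w0 id f) => x y [cw g cw' _ z].
  apply: file_eq_lib.
  - exact: (decode1 d x y).
  - exact: (decode1 d' x y).
have := ent_pair w w0 w1 (fun x => (m x, m' x)) (cache1 S).
have := ent_pair w w0 w1 m m'.
have := ent_cache1; have := ent_msg dl d dl0 n0; have := ent_msg dl d' dl0 n0.
rewrite -/f -/m -/m'; lra.
Qed.

(* Both (cache 1, message for [(j, j')]) and (cache 2, message for [(j', j)])
   determine file [j]; together they determine the library, so submodularity
   counts file [j] twice. *)
Lemma cut_submod (T : eqType) (j j' : 'I_2) (f : Lib -> T) dl :
  (forall x y, file_eq j x y -> f x = f y) ->
  (forall x y : Lib, file_eq j x y -> file_eq j' x y -> x = y) ->
  0 < dl -> (0 < n)%N ->
  n%:R * (H12 p * ln 2) + ent w f <= n%:R * (2 * M * ln 2) + 2 * msg_cost dl.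
Proof.
move=> fj jj' dl0 n0; pose d : demand := (j, j'); pose d' : demand := (j', j).
pose u x := ((codeword S d x, genie x), cache1 S x).
pose v x := ((codeword S d' x, genie x), cache2 S x).
pose fg x := (f x, genie x).
have A : ent w (fun x => (fg x, u x)) <= ent w u.
  apply: ent_le => // x y [cw g z]; rewrite /fg /u cw g z.
  by rewrite (fj x y) //; apply: (decode1 d).
have B : ent w (fun x => (fg x, v x)) <= ent w v.
  apply: ent_le => // x y [cw g z]; rewrite /fg /v cw g z.
  by rewrite (fj x y) //; apply: (decode2 d').
(* File [j'] comes from a cross combination: receiver 2 reads the message for [d], stored in [u],
   with its cache, stored in [v]. *)
have C : ent w id <= ent w (fun x => ((fg x, u x), v x)).
  apply: ent_le => // x y [_ _ cw g z1 cw' _ z2]; apply: jj'.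
  - exact: (decode1 d).
  - exact: (decode2 d).
have D : ent w f <= ent w fg by apply: ent_le => // x y [].
have := ent_submod w w0 w1 fg u v.
have := ent_pair w w0 w1 (fun x => (codeword S d x, genie x)) (cache1 S).
have := ent_pair w w0 w1 (fun x => (codeword S d' x, genie x)) (cache2 S).
have := ent_cache1; have := ent_cache2.
have := ent_msg dl d dl0 n0; have := ent_msg dl d' dl0 n0.
rewrite ent_lib // in C; rewrite -/u -/v; lra.
Qed.

Lemma cut_cross dl : 0 < dl -> (0 < n)%N ->
  n%:R * ((H12 p + Num.max (H1 p) (H2 p)) * ln 2) <=
  n%:R * (2 * M * ln 2) + 2 * msg_cost dl.
Proof.
move=> dl0 n0.
have I1 : n%:R * ((H12 p + H1 p) * ln 2) <=
          n%:R * (2 * M * ln 2) + 2 * msg_cost dl.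
  rewrite [X in _ * X]mulrDl mulrDr -ent_lib1 //.
  apply: (cut_submod _ ord0 ord_max) => // x y; last exact: file_eq_lib.
  by move=> /eqP.
have I2 : n%:R * ((H12 p + H2 p) * ln 2) <=
          n%:R * (2 * M * ln 2) + 2 * msg_cost dl.
  rewrite [X in _ * X]mulrDl mulrDr -ent_lib2 //.
  apply: (cut_submod _ ord_max ord0) => // x y; first by move=> /eqP.
  by move=> h1 h0; exact: file_eq_lib.
by rewrite /Num.max; case: ifP.
Qed.

End Scheme.
End Converse.

(** * Passage to the limit and to the closure *)

Section Asymptotics.
Local Open Scope classical_set_scope.
Context {R : realType}.

Lemma limn_esup_near (u : nat -> R) (l e : R) :
  (limn_esup (fun k => (u k)%:E) <= l%:E)%E -> 0 < e ->
  \forall k \near \oo, u k <= l + e.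
Proof.
move=> ul e0.
have : (limn_esup (fun k => (u k)%:E) < (l + e)%:E)%E.
  by apply: le_lt_trans ul _; rewrite lte_fin ltrDl.
rewrite /limn_esup /limf_esup => /ereal_inf_lt[_ [V Voo <-] supV].
apply: filterS Voo => k Vk; rewrite -lee_fin; apply: le_trans (ltW supV).
by apply: ereal_sup_ubound; exists k.
Qed.

Context {X1 X2 : finType} (p : X1 -> X2 -> R).

(** Divide the cut by the block length. Two limits follow: first [k] tends to infinity at fixed
    [dl], removing the constant and error terms, then [dl] tends to 0, turning [ln 2 + dl] into
    [ln 2]. *)
Lemma achievable_bound (Rt M A a b : R) : 0 <= b ->
  (forall n (S : cacm X1 X2 n M) dl, 0 < dl -> (0 < n)%N ->
     n%:R * (A * ln 2) <= n%:R * (a * M * ln 2) + b * msg_cost p S dl) ->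
  achievable p Rt M -> A <= a * M + b * Rt.
Proof.
move=> b0 cut [ns [S [ns_lt [Pe0 sup_rate]]]].
have ln2 : 0 < ln 2 :> R by rewrite ln_gt0 // ltr1n.
have ns_ge k : (k <= ns k)%N.
  by elim: k => // k IH; exact: leq_ltn_trans IH (ns_lt k).
have step dl : 0 < dl ->
    A * ln 2 <= a * M * ln 2 + b * ((ln 2 + dl) * (Rt + dl)).
  move=> dl0.
  pose L : R := ln #|{: X1 * X2}|%:R.
  pose C : R := ln 2 - ln (1 - expR (- dl)).
  pose c := a * M * ln 2 + b * ((ln 2 + dl) * (Rt + dl)).
  (* Since [ns k >= k], the inverse of [ns k] is at most [2 * harmonic k = 2 / (k + 1)] for
     [k >= 1]. The absolute value avoids discussing the sign of [C]. *)
  pose g k := c + b * (2 * `|C| * harmonic k + 8 * L * Pe p (S k)).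
  have gc : g k @[k --> \oo] --> c.
    have : g k @[k --> \oo] --> c + b * (2 * `|C| * 0 + 8 * L * 0).
      exact: (cvgD (cvg_cst c) (cvgM (cvg_cst b) (cvgD
        (cvgM (cvg_cst (2 * `|C|)) (@cvg_harmonic R))
        (cvgM (cvg_cst (8 * L)) Pe0)))).
    by rewrite !mulr0 addr0 mulr0 addr0.
  apply: (ler_cvg_to (cvg_cst (A * ln 2)) gc).
  near=> k.
  have k0 : (0 < k)%N by near: k; exact: nbhs_infty_gt.
  have n0 : (0 < ns k)%N := leq_trans k0 (ns_ge k).
  have r : rate p (S k) <= Rt + dl.
    by near: k; exact: (limn_esup_near _ _ _ sup_rate dl0).
  have nR : 0 < (ns k)%:R :> R by rewrite ltr0n.
  have := cut _ (S k) dl dl0 n0; rewrite /msg_cost -/L.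
  rewrite -[X in _ -> is_true X](ler_pM2l nR) => /le_trans; apply.
  rewrite /g /c.
  have h : 1 <= (ns k)%:R * (2 * harmonic k) :> R.
    rewrite /harmonic mulrA ler_pdivlMr ?ltr0n // mul1r -natrM ler_nat.
    by have := ns_ge k; lia.
  have hC : C <= (ns k)%:R * (2 * `|C| * harmonic k).
    apply: le_trans (ler_norm C) _.
    by have := ler_wpM2l (normr_ge0 C) h; lra.
  have hr : (ns k)%:R * ((ln 2 + dl) * rate p (S k)) <=
            (ns k)%:R * ((ln 2 + dl) * (Rt + dl)).
    by rewrite ler_pM2l // ler_pM2l // addr_gt0.
  have := ler_wpM2l b0 (lerD hr hC); rewrite /C; lra.
(* The slack [dl] now runs through [harmonic k]. *)
pose h k := a * M * ln 2 + b * ((ln 2 + harmonic k) * (Rt + harmonic k)).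
have hl : h k @[k --> \oo] --> a * M * ln 2 + b * ((ln 2 + 0) * (Rt + 0)).
  have hh := @cvg_harmonic R.
  exact: (cvgD (cvg_cst _) (cvgM (cvg_cst b)
    (cvgM (cvgD (cvg_cst (ln 2)) hh) (cvgD (cvg_cst Rt) hh)))).
have := ler_cvg_to (cvg_cst (A * ln 2)) hl.
rewrite !addr0 => H.
rewrite -(ler_pM2r ln2) mulrDl -[X in _ + X]mulrA [Rt * _]mulrC; apply: H.
by apply: nearW => k; apply: step; exact: harmonic_gt0.
Unshelve. all: by end_near. Qed.

(** The inequality defines a closed half-plane of pairs. The cut is assumed for every cache size
    because a point of the closure is approached by pairs with other values of [M]. *)
Lemma region_bound (Rt M A a b : R) : 0 <= b ->
  (forall n M (S : cacm X1 X2 n M) dl, 0 < dl -> (0 < n)%N ->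
     n%:R * (A * ln 2) <= n%:R * (a * M * ln 2) + b * msg_cost p S dl) ->
  region p (Rt, M) -> A <= a * M + b * Rt.
Proof.
move=> b0 cut.
pose F (x : R * R) := a * x.2 + b * x.1.
have Fc : continuous F.
  move=> x.
  exact: (cvgD (cvgM (cvg_cst a) cvg_snd) (cvgM (cvg_cst b) cvg_fst)).
have Fcl : closed (F @^-1` [set y | A <= y]).
  by apply: closed_comp; [move=> x _; exact: Fc|exact: closed_ge].
move=> RtM; have {RtM} : closure (F @^-1` [set y | A <= y]) (Rt, M).
  apply: closure_subset RtM => -[Rt' M'] /= ach.
  by apply: (achievable_bound Rt' M' A a b b0) => // n S; exact: cut.
by move/closure_id: Fcl => <-.
Qed.

End Asymptotics.

Theorem theorem1 (R : realType) (X1 X2 : finType) (p : X1 -> X2 -> R)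
  (p_ge0 : forall a b, 0 <= p a b)
  (p_sum1 : \sum_(a : X1) \sum_(b : X2) p a b = 1)
  (M : R) (hM : 0 <= M) :
  (RLB p M <= Rstar p M)%E.
Proof.
(* Both sides are infima, so it suffices that every rate in the region at [M] satisfies the three
   constraints. *)
rewrite /RLB /Rstar; apply: le_ereal_inf => _ [Rt RtM <-]; exists Rt => //.
have I1 : H12 p <= 2 * M + 1 * Rt.
  apply: (region_bound p) RtM => // n M' S dl dl0 n0.
  by rewrite mul1r; exact: cut_two_caches.
have I2 : H12 p <= 1 * M + 2 * Rt.
  apply: (region_bound p) RtM => // n M' S dl dl0 n0.
  exact: cut_two_messages.
have I3 : H12 p + Num.max (H1 p) (H2 p) <= 2 * M + 2 * Rt.
  apply: (region_bound p) RtM => // n M' S dl dl0 n0.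
  exact: cut_cross.
by split; lra.
Qed.
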